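(* Let $\alpha,\beta$ be real with $4\alpha-\beta^2>0$, and let $\Omega\subseteq\mathbb{R}^2$ be an open connected set. Suppose $f_n:\Omega\to\mathbb{C}(\alpha,\beta)$, $n\geq0$, are holomorphic and the sequence $(f_n)$ converges to a function $f$, uniformly on every compact subset of $\Omega$. Then $f$ is holomorphic in $\Omega$.
   Context: $\mathbb{C}(\alpha,\beta)$ denotes the real algebra of numbers $z=x+iy$ with $i^2=-\alpha-\beta i$ (product $(x_1+iy_1)(x_2+iy_2)=(x_1x_2-\alpha y_1y_2)+i(x_1y_2+x_2y_1-\beta y_1y_2)$), identified with $\mathbb{R}^2$ and carrying the Euclidean topology. A function $f=u+iv$ on $\Omega$ ($u,v$ real, continuously differentiable) is holomorphic if $\partial_{\bar z}f:=\tfrac12(\partial_xf+i\partial_yf)=0$, i.e. $\partial_xu-\alpha\partial_yv=0$ and $\partial_yu+\partial_xv-\beta\partial_yv=0$. *)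

(* Defs.v *)
(* Points of R^2 = R * R (product topology
   = Euclidean topology); elements x+iy of C(alpha,beta) are pairs (x, y). *)
From HB Require Import structures.
From mathcomp Require Import all_boot all_order all_algebra.
From mathcomp Require Import all_classical all_reals all_analysis.
Set Implicit Arguments. Unset Strict Implicit. Unset Printing Implicit Defensive.
Import Order.TTheory GRing.Theory Num.Theory.
Import numFieldNormedType.Exports.
Local Open Scope classical_set_scope.
Local Open Scope ring_scope.

Section CAB.
Variable R : realType.

(* Multiplication in C(alpha,beta), where i^2 = -alpha - beta i. *)
Definition mulCab (a b : R) (z w : R * R) : R * R :=
  (z.1 * w.1 - a * z.2 * w.2, z.1 * w.2 + w.1 * z.2 - b * z.2 * w.2).

Definition ex : R * R := (1, 0).
Definition ey : R * R := (0, 1).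

Definition C1_on (Om : set (R * R)) (g : R * R -> R) : Prop :=
  (forall p, Om p -> derivable g p ex /\ derivable g p ey) /\
  (forall p, Om p -> ('D_ex g q) @[q --> p] --> 'D_ex g p) /\
  (forall p, Om p -> ('D_ey g q) @[q --> p] --> 'D_ey g p).

Definition holomorphic (a b : R) (Om : set (R * R)) (f : R * R -> R * R) : Prop :=
  let u := fun p => (f p).1 in
  let v := fun p => (f p).2 in
  C1_on Om u /\ C1_on Om v /\
  (forall p, Om p ->
     'D_ex u p - a * 'D_ey v p = 0 /\
     'D_ey u p + 'D_ex v p - b * 'D_ey v p = 0).

Definition unif_cvg_compact (Om : set (R * R)) (fn : nat -> R * R -> R * R)
  (f : R * R -> R * R) : Prop :=
  forall K : set (R * R), K `<=` Om -> compact K ->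
  forall e : R, 0 < e -> exists N : nat, forall n : nat, (N <= n)%N ->
    forall z, K z -> `|(fn n z).1 - (f z).1| < e /\ `|(fn n z).2 - (f z).2| < e.
End CAB.

(* Main.v *)
(* Holomorphic functions satisfy a Cauchy estimate: their partial derivatives at a point are
   bounded by a constant times the supremum of the function on a surrounding square, divided
   by its side.  Applied to the differences [fn n - fn m], this makes the partial derivatives
   locally uniformly Cauchy, so [f] is continuously differentiable and the defining linear
   equations pass to the limit.  The estimate comes from the fact that the circular means of
   [(f(p + r e^(it)) - f(p)) e^(-it) / r] do not depend on [r]; Riemann sums in [t] and the
   mean value theorem stand in for the integrals. *)
Require Import Defs.
From HB Require Import structures.
From mathcomp Require Import all_boot all_order all_algebra.
From mathcomp Require Import all_classical all_reals all_analysis.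
From mathcomp Require Import ring lra.
Set Implicit Arguments. Unset Strict Implicit. Unset Printing Implicit Defensive.
Import Order.TTheory GRing.Theory Num.Theory.
Import numFieldNormedType.Exports.
Local Open Scope classical_set_scope.
Local Open Scope ring_scope.

(** * Mean values along lines and differentiability from continuous partial derivatives *)

Lemma is_derive_line (R : realType) (V : normedModType R) (g : V -> R) (q d : V) (t : R) :
  derivable g (q + t *: d) d ->
  is_derive t 1 (fun s : R => g (q + s *: d)) ('D_d g (q + t *: d)).
Proof.
move=> dg; have E : (fun h : R => h^-1 *: (((fun s : R => g (q + s *: d)) \o shift t) (h *: 1)
                                           - g (q + t *: d)))
   = (fun h : R => h^-1 *: ((g \o shift (q + t *: d)) (h *: d) - g (q + t *: d))).
  apply/funext => h /=; congr (_ *: (g _ - _)).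
  by rewrite [h *: 1]mulr1 scalerDl addrCA.
by split; rewrite /derivable /derive E.
Qed.

(** Locating the intermediate parameter only by [|t| <= |h|] covers both signs of [h] at once. *)
Lemma MVT_line (R : realType) (V : normedModType R) (g : V -> R) (q d : V) (h : R) :
  (forall t, `|t| <= `|h| -> derivable g (q + t *: d) d) ->
  exists2 t, `|t| <= `|h| & g (q + h *: d) - g q = h * 'D_d g (q + t *: d).
Proof.
move=> dg; pose phi := fun s : R => g (q + s *: d).
have dphi s : `|s| <= `|h| -> is_derive s (1 : R) phi ('D_d g (q + s *: d)).
  by move=> sh; apply: is_derive_line; exact: dg.
have -> : g q = phi 0 by rewrite /phi scale0r addr0.
rewrite -/(phi h).
have cphi a c : (forall s, s \in `[a, c] -> `|s| <= `|h|) ->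
    {within `[a, c], continuous phi}.
  move=> H; apply: derivable_within_continuous => s /H /dphi dd.
  exact: ex_derive.
have [h0|h0] := leP 0 h.
  have H s : s \in `[0, h] -> `|s| <= `|h|.
    by rewrite in_itv /= => /andP[s0 sh]; rewrite !ger0_norm.
  have [|t th ->] := @MVT_segment _ phi (fun s => 'D_d g (q + s *: d)) _ _ h0 _ (cphi _ _ H).
    by move=> s sI; apply/dphi/H/subset_itv_oo_cc.
  by exists t; [exact: H|rewrite subr0 mulrC].
have H s : s \in `[h, 0] -> `|s| <= `|h|.
  by rewrite in_itv /= => /andP[s0 sh]; rewrite !ler0_norm// ?lerN2// ltW.
have [|t th E] := @MVT_segment _ phi (fun s => 'D_d g (q + s *: d)) _ _ (ltW h0) _ (cphi _ _ H).
  by move=> s sI; apply/dphi/H/subset_itv_oo_cc.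
exists t; first exact: H.
by rewrite -opprB E sub0r mulrN opprK mulrC.
Qed.

Lemma littleo_differentiable (K : numFieldType) (V W : normedModType K) (f : V -> W)
    (df : {linear V -> W}) (x : V) :
  continuous df ->
  (forall e, 0 < e -> \forall h \near 0, `|f (h + x) - (f x + df h)| <= e * `|h|) ->
  differentiable f x.
Proof.
move=> cdf H.
have E : f \o shift x = cst (f x) + df +o_ 0 id by apply/eqaddoP => e /H.
by apply/diff_locallyP; rewrite (diff_unique cdf E).
Qed.

(** The increment is split into a horizontal and a vertical move, each treated by the mean value
    theorem. [C1_on] speaks of two directions only, whereas the chain rule and oblique directions
    call for full differentiability. *)
Lemma C1_differentiable (R : realType) (Om : set (R * R)) (g : R * R -> R) (p : R * R) :
  open Om -> C1_on Om g -> Om p -> differentiable g p.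
Proof.
move=> oOm [dg [cx cy]] Omp.
pose a : R := 'D_(ex R) g p; pose b : R := 'D_(ey R) g p.
pose L : R * R -> R := fun h => h.1 * a + h.2 * b.
have cL : continuous L.
  move=> h; apply: cvgD; apply: cvgMl; [exact: cvg_fst|exact: cvg_snd].
have [lL lLE] : exists lL : {linear (R * R)%type -> R}, lL = L :> (R * R -> R).
  have linL : linear L.
    by move=> k u v; rewrite /L /GRing.scale /= !mulrDl !mulrDr -!mulrA addrACA.
  by exists (HB.pack_for {linear (R * R)%type -> R} L
    (GRing.isLinear.Build _ _ _ _ _ linL)).
apply: (@littleo_differentiable R (R * R)%type R g lL); rewrite lLE // => _/posnumP[e].
have e2 : 0 < e%:num / 2 by [].
have /cvgrPdist_le/(_ _ e2) nx := cx p Omp.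
have /cvgrPdist_le/(_ _ e2) ny := cy p Omp.
have nO : \forall q \near p, Om q by exact: open_nbhs_nbhs.
have /nbhs_ballP[r /= r0 rP] : \forall q \near p, [/\ Om q,
    `|a - 'D_(ex R) g q| <= e%:num / 2 & `|b - 'D_(ey R) g q| <= e%:num / 2].
  by apply: filterS3 nO nx ny => q.
near=> h.
have hr : `|h| < r.
  by near: h; apply/nbhs_ballP; exists r => //= y; rewrite -ball_normE /= sub0r normrN.
have h1 : `|h.1| <= `|h| by rewrite prod_normE /= le_max lexx.
have h2 : `|h.2| <= `|h| by rewrite prod_normE /= le_max lexx orbT.
(* In the max norm the whole square of half-side [|h|] around [p] lies in the ball, hence so do both
   intermediate points. *)
have rPs s t : `|s| <= `|h| -> `|t| <= `|h| -> [/\ Om (p + (s, t)),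
    `|a - 'D_(ex R) g (p + (s, t))| <= e%:num / 2 &
    `|b - 'D_(ey R) g (p + (s, t))| <= e%:num / 2].
  move=> sh th; apply: rP; rewrite -ball_normE /= opprD addNKr normrN.
  by rewrite prod_normE gt_max /= !(le_lt_trans _ hr).
have h0 : `|0 : R| <= `|h| by rewrite normr0.
have exE s : s *: ex R = (s, 0) by congr pair; [exact: mulr1|exact: mulr0].
have eyE s : s *: ey R = (0, s) by congr pair; [exact: mulr0|exact: mulr1].
have [t th E1] : exists2 t, `|t| <= `|h.1| &
    g (p + h.1 *: ex R) - g p = h.1 * 'D_(ex R) g (p + t *: ex R).
  apply: MVT_line => t th; rewrite exE.
  have [Oq _ _] := rPs t 0 (le_trans th h1) h0; exact: (dg _ Oq).1.
have [s sh E2] : exists2 s, `|s| <= `|h.2| &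
    g (p + h.1 *: ex R + h.2 *: ey R) - g (p + h.1 *: ex R) =
    h.2 * 'D_(ey R) g (p + h.1 *: ex R + s *: ey R).
  apply: MVT_line => s sh; rewrite exE eyE -addrA.
  have -> : (h.1, 0) + (0, s) = (h.1, s) by congr pair; rewrite /= ?addr0 ?add0r.
  have [Oq _ _] := rPs h.1 s h1 (le_trans sh h2); exact: (dg _ Oq).2.
have hE : h + p = p + h.1 *: ex R + h.2 *: ey R.
  rewrite exE eyE -addrA addrC; congr (_ + _).
  by rewrite [LHS]surjective_pairing; congr pair; rewrite /= ?addr0 ?add0r.
have [_ Da _] := rPs t 0 (le_trans th h1) h0.
have [_ _ Db] := rPs h.1 s h1 (le_trans sh h2).
have tE : p + (t, 0) = p + t *: ex R by rewrite exE.
have sE : p + (h.1, s) = p + h.1 *: ex R + s *: ey R.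
  rewrite exE eyE -addrA; congr (_ + _).
  by congr pair; rewrite /= ?addr0 ?add0r.
rewrite {}tE in Da; rewrite {}sE in Db; rewrite {}hE /L.
move: E1 E2 Da Db; set A := 'D_(ex R) g _; set B := 'D_(ey R) g _ => E1 E2 Da Db.
have -> : g (p + h.1 *: ex R + h.2 *: ey R) - (g p + (h.1 * a + h.2 * b)) =
    - (h.1 * (a - A) + h.2 * (b - B)).
  rewrite -[g (p + h.1 *: ex R + h.2 *: ey R)](subrK (g (p + h.1 *: ex R))) E2.
  by rewrite -[g (p + h.1 *: ex R)](subrK (g p)) E1; ring.
have -> : e%:num * `|h| = `|h| * (e%:num / 2) + `|h| * (e%:num / 2).
  by rewrite -mulrDr -splitr mulrC.
rewrite normrN (le_trans (ler_normD _ _))// !normrM.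
by apply: lerD; apply: ler_pM.
Unshelve. all: by end_near.
Qed.

(** * Riemann sums of a closed form *)

(** Near-covering compactness: half of the radius given by continuity at a point is left for the
    vertical displacement. The displaced point may leave [K], since continuity at points of [K] is
    understood in the whole plane. *)
Lemma uniform_continuity_snd (R : realType) (D : R * R -> R) (K : set (R * R)) (w : R) :
  compact K -> (forall x, K x -> {for x, continuous D}) -> 0 < w ->
  \forall i \near 0^'+, forall x, K x -> forall t, `|t - x.2| <= i -> `|D (x.1, t) - D x| <= w.
Proof.
move=> /compact_near_coveringP cK cD w0.
apply: (cK R (0^'+) (fun i x => forall t, `|t - x.2| <= i -> `|D (x.1, t) - D x| <= w)) => x Kx.
have w2 : 0 < w / 2 by rewrite divr_gt0.
have /cvgrPdist_le/(_ _ w2)/nbhs_ballP[r /= r0 rP] := cD _ Kx.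
exists (ball x (r / 2), [set i | i < r / 2]) => /=.
  split; first by apply: nbhsx_ballx; rewrite divr_gt0.
  by apply: nbhs_right_lt; rewrite divr_gt0.
move=> [y i] /= [[y1 y2] ir] t ty.
have by1 : ball x r y by split; [apply: le_ball y1|apply: le_ball y2]; lra.
have by2 : ball x r (y.1, t).
  split; first by apply: le_ball y1; lra.
  move: y2; rewrite /ball /= /ball_; have := ler_distD y.2 x.2 t.
  by rewrite (distrC y.2 t) /=; lra.
have := rP _ by1; have := rP _ by2.
rewrite !ler_norml => /andP[? ?] /andP[? ?]; apply/andP; split; lra.
Qed.

(* The form [P dt + Q ds] is closed, so the integral of [P s] over a period of [Q s] does
   not depend on [s]; Riemann sums replace the integrals. *)
Lemma periodic_closed_form_le (R : realType) (P Q : R -> R -> R) (D : R * R -> R)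
    (s1 s2 T m M : R) :
  s1 < s2 -> 0 < T ->
  (forall s t, s1 <= s <= s2 -> is_derive s (1 : R) (P^~ t) (D (s, t))) ->
  (forall s t, s1 <= s <= s2 -> is_derive t (1 : R) (Q s) (D (s, t))) ->
  (forall s t, s1 <= s <= s2 -> {for (s, t), continuous D}) ->
  (forall s, s1 <= s <= s2 -> Q s T = Q s 0) ->
  (forall t, m <= P s1 t) -> (forall t, P s2 t <= M) -> m <= M.
Proof.
move=> s12 T0 dP dQ cD QT mP PM; apply/ler_addgt0Pr => e e0.
(* An error [w] per unit of [s] accumulates to [e] between [s1] and [s2]. *)
pose w := e / (s2 - s1).
have s0 : 0 < s2 - s1 by rewrite subr_gt0.
have w0 : 0 < w by rewrite divr_gt0.
have cK : compact (`[s1, s2] `*` `[0, T]).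
  by apply: compact_setX; exact: segment_compact.
have cDK x : (`[s1, s2] `*` `[0, T]) x -> {for x, continuous D}.
  by case: x => s t [/= sI _]; apply: cD; move: sI; rewrite in_itv.
have [d /= d0 dP'] := uniform_continuity_snd cK cDK w0.
have [N NP] : exists N : nat, T / N.+1%:R < d.
  exists (Num.truncn (T / d)); rewrite ltr_pdivrMr// mulrC -ltr_pdivrMr//.
  exact: truncnS_gt.
set h := T / N.+1%:R in NP.
have h0 : 0 < h by rewrite divr_gt0.
have hT : N.+1%:R * h = T by rewrite mulrC divfK.
(* The increment over one step is [h] times [D] at an intermediate point, which is moved to the node
   at the cost of [w]. That point is only known to be within [h] of the node, so it may fall outside
   [[0, T]]. *)
have slope s (k : 'I_N.+1) : s1 <= s <= s2 ->
    Q s (k.+1%:R * h) - Q s (k%:R * h) <= h * (D (s, k%:R * h) + w).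
  move=> sI.
  have [t th E] : exists2 t, `|t| <= `|h| & Q s (k%:R * h + h *: (1 : R)) - Q s (k%:R * h) =
      h * 'D_1 (Q s) (k%:R * h + t *: (1 : R)).
    by apply: MVT_line => t _; have dd := dQ s (k%:R * h + t *: (1 : R)) sI; exact: ex_derive.
  have dd := dQ s (k%:R * h + t *: (1 : R)) sI.
  move: E; rewrite derive_val ![_ *: 1]mulr1 -natr1 mulrDl mul1r => ->.
  rewrite ler_pM2l// -lerBlDl.
  apply: le_trans (ler_norm _) _.
  apply: (dP' h _ h0 (s, k%:R * h)).
  - by rewrite /ball /= sub0r normrN gtr0_norm.
  - split; rewrite /= in_itv //=; rewrite mulr_ge0 ?(ltW h0)//=.
    by rewrite -hT ler_pM2r// ler_nat ltnW.
  - by rewrite /= addrAC subrr add0r (le_trans th)// gtr0_norm.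
(* Up to the factor [h], this is the Riemann sum for the integral of [P s] over a period. *)
pose F s := \sum_(k < N.+1) P s (k%:R * h).
have dF s : s1 <= s <= s2 -> is_derive s (1 : R) F (\sum_(k < N.+1) D (s, k%:R * h)).
  move=> sI; have -> : F = \sum_(k < N.+1) P^~ (k%:R * h).
    by apply/funext => x; rewrite fct_sumE.
  by apply: is_derive_sum => k; exact: dP.
have [s||s sI E] := @MVT_segment _ F (fun s => \sum_(k < N.+1) D (s, k%:R * h)) _ _ (ltW s12).
- by rewrite in_itv /= => /andP[? ?]; apply: dF; rewrite !ltW.
- apply: derivable_within_continuous => s; rewrite in_itv /= => /dF dd.
  exact: ex_derive.
rewrite in_itv /= in sI.
have tele : \sum_(k < N.+1) (Q s (k.+1%:R * h) - Q s (k%:R * h)) = 0.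
  rewrite -(big_mkord xpredT (fun k => Q s (k.+1%:R * h) - Q s (k%:R * h))).
  by rewrite (telescope_sumr (fun k => Q s (k%:R * h)))// hT mul0r QT// subrr.
(* By periodicity the increments of [Q s] sum to [0], so the derivative of [F] is at least
   [- (N + 1) w] and [F] drops by at most [(N + 1) e] from [s1] to [s2]. *)
have lbD : 0 <= \sum_(k < N.+1) D (s, k%:R * h) + N.+1%:R * w.
  have : \sum_(k < N.+1) (Q s (k.+1%:R * h) - Q s (k%:R * h)) <=
      \sum_(k < N.+1) h * (D (s, k%:R * h) + w) by apply: ler_sum => k _; exact: slope.
  by rewrite tele -mulr_sumr big_split /= sumr_const card_ord pmulr_rge0// mulr_natl.
have Fm : N.+1%:R * m <= F s1.
  have -> : N.+1%:R * m = \sum_(k < N.+1) m by rewrite sumr_const card_ord mulr_natl.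
  by apply: ler_sum.
have FM : F s2 <= N.+1%:R * M.
  have -> : N.+1%:R * M = \sum_(k < N.+1) M by rewrite sumr_const card_ord mulr_natl.
  by apply: ler_sum.
have ew : e = w * (s2 - s1) by rewrite divfK// gt_eqF.
rewrite -(ler_pM2l (ltr0Sn R N)) ew (le_trans Fm)//.
have := mulr_ge0 (ltW s0) lbD; lra.
Qed.

(** * Limits of directional derivatives *)

(** Multiplied through by [h], the difference quotient yields estimates linear in the values of [g],
    which can be added up. *)
Lemma derivable_quotient_near (R : realType) (V : normedModType R) (g : V -> R) (q d : V) (e : R) :
  derivable g q d -> 0 < e ->
  \forall h \near 0^', `|g (q + h *: d) - g q - h * 'D_d g q| <= `|h| * e.
Proof.
move=> dg e0; have /cvgrPdist_le/(_ _ e0) H := dg.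
near=> h.
have h0 : h != 0 by near: h; exact: nbhs_dnbhs_neq.
have -> : g (q + h *: d) - g q - h * 'D_d g q =
    - (h * ('D_d g q - h^-1 * (g (h *: d + q) - g q))).
  by rewrite [h *: d + q]addrC; field.
rewrite normrN normrM ler_wpM2l//.
by near: h; exact: H.
Unshelve. all: by end_near.
Qed.

Lemma derivable_of_quotient (R : realType) (V : normedModType R) (g : V -> R) (q d : V) (l : R) :
  (forall e, 0 < e -> \forall h \near 0^', `|g (q + h *: d) - g q - h * l| <= `|h| * e) ->
  is_derive q d g l.
Proof.
move=> H.
have C : (fun h => h^-1 *: ((g \o shift q) (h *: d) - g q)) @ 0^' --> l.
  apply/cvgrPdist_le => e /H He.
  near=> h.
  have h0 : h != 0 by near: h; exact: nbhs_dnbhs_neq.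
  have hp : 0 < `|h| by rewrite normr_gt0.
  rewrite -(ler_pM2l hp) -normrM -normrN.
  have -> : - (h * (l - h^-1 *: ((g \o shift q) (h *: d) - g q))) = 
      g (q + h *: d) - g q - h * l.
    by rewrite /= [h *: d + q]addrC /GRing.scale /=; field.
  by near: h.
split; first by apply/cvg_ex; exists l.
exact: cvg_lim.
Unshelve. all: by end_near.
Qed.

(** By the mean value theorem the increment of [g m - g n] over [h] is at most [|h|] times the gap
    between the derivatives, uniformly in [m]; so [f] inherits its linear approximation from a
    single [g n]. *)
Lemma derivable_limit (R : realType) (V : normedModType R) (O : set V) (d : V)
    (g : nat -> V -> R) (f : V -> R) :
  open O ->
  (forall n q, O q -> derivable (g n) q d) ->
  (forall e, 0 < e -> exists N, forall n m, (N <= n)%N -> (N <= m)%N ->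
     forall q, O q -> `|'D_d (g n) q - 'D_d (g m) q| <= e) ->
  (forall q, O q -> g n q @[n --> \oo] --> f q) ->
  (forall q, O q -> derivable f q d) /\
  (forall e, 0 < e -> exists N, forall n, (N <= n)%N ->
     forall q, O q -> `|'D_d (g n) q - 'D_d f q| <= e).
Proof.
move=> oO dg cau gf.
pose l q := lim ('D_d (g n) q @[n --> \oo]).
have Dl q : O q -> 'D_d (g n) q @[n --> \oo] --> l q.
  move=> Oq; apply/cauchy_cvgP/cauchy_exP => e e0.
  have e2 : 0 < e / 2 by rewrite divr_gt0.
  have [N NP] := cau _ e2.
  exists ('D_d (g N) q); exists N => // n /= Nn.
  rewrite /ball /= /ball_ (le_lt_trans (NP _ _ (leqnn N) Nn _ Oq))//; lra.
have ul e : 0 < e -> exists N, forall n, (N <= n)%N ->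
     forall q, O q -> `|'D_d (g n) q - l q| <= e.
  move=> e0; have e2 : 0 < e / 2 by rewrite divr_gt0.
  have [N NP] := cau _ e2; exists N => n Nn q Oq.
  have /cvgrPdist_le/(_ _ e2)[M _ MP] := Dl q Oq.
  have Nm := leq_maxl N M; have /MP := leq_maxr N M.
  have := NP _ _ Nn Nm _ Oq; set m := maxn N M.
  rewrite !ler_norml => /andP[? ?] /andP[? ?]; apply/andP; split; lra.
have dl q : O q -> is_derive q d f (l q).
  move=> Oq; apply: derivable_of_quotient => e e0.
  (* Five errors: [f] against [g m] at [q] and at [q + h *: d], the mean value bound for
     [g m - g n], the linear approximation of [g n], and the distance of its derivative to [l q]. *)
  have e5 : 0 < e / 5%:R by rewrite divr_gt0.
  have [N NP] := cau _ e5; have [N' N'P] := ul _ e5.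
  pose n := maxn N N'; have Nn : (N <= n)%N := leq_maxl _ _.
  have Dn := derivable_quotient_near (dg n q Oq) e5.
  have [r /= r0 rP] : \forall t \near (0 : R), O (q + t *: d).
    have : (q + t *: d) @[t --> (0 : R)] --> q + 0 *: d.
      by apply: cvgD; [exact: cvg_cst|apply: cvgZr_tmp; exact: cvg_id].
    by apply; rewrite scale0r addr0; exact: open_nbhs_nbhs.
  near=> h.
  have h0 : h != 0 by near: h; exact: nbhs_dnbhs_neq.
  (* This tolerance depends on [h], so [m] is chosen after [h], while [n] was fixed before. *)
  have he : 0 < `|h| * (e / 5%:R) by rewrite mulr_gt0 ?normr_gt0.
  have Oh t : `|t| <= `|h| -> O (q + t *: d).
    move=> th; apply: rP; rewrite /= sub0r normrN (le_lt_trans th)//.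
    near: h; apply: nbhs_dnbhs; apply/nbhs_ballP; exists r => //= y.
    by rewrite /ball /= sub0r normrN.
  have /cvgrPdist_le/(_ _ he)[M1 _ M1P] := gf _ Oq.
  have /cvgrPdist_le/(_ _ he)[M2 _ M2P] := gf _ (Oh h (lexx _)).
  pose m := maxn N (maxn M1 M2).
  have Nm : (N <= m)%N := leq_maxl _ _.
  have /M1P {}M1P : (M1 <= m)%N by rewrite !leq_max leqnn orbT.
  have /M2P {}M2P : (M2 <= m)%N by rewrite !leq_max leqnn !orbT.
  have [t th E] : exists2 t, `|t| <= `|h| &
      (g m \- g n) (q + h *: d) - (g m \- g n) q = h * 'D_d (g m \- g n) (q + t *: d).
    by apply: MVT_line => t /Oh Ot; apply: derivableB; exact: dg.
  have /(_ _ (Oh _ th)) {}NP := NP _ _ Nm Nn.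
  have {}N'P := N'P n (leq_maxr _ _) q Oq.
  have Dn' : `|g n (q + h *: d) - g n q - h * 'D_d (g n) q| <= `|h| * (e / 5%:R).
    by near: h; exact: Dn.
  rewrite deriveB in E; [|by apply: dg; exact: Oh|by apply: dg; exact: Oh].
  have {}NP := ler_wpM2l (normr_ge0 h) NP; rewrite -normrM -E in NP.

  have {}N'P := ler_wpM2l (normr_ge0 h) N'P; rewrite -normrM mulrBr in N'P.
  move: NP N'P Dn' M1P M2P; rewrite /= !ler_norml.
  move=> /andP[? ?] /andP[? ?] /andP[? ?] /andP[? ?] /andP[? ?]; apply/andP; split; lra.
split=> [q /dl dq|e /ul[N NP]]; first exact: ex_derive.
by exists N => n Nn q Oq; have dq := dl q Oq; rewrite derive_val; exact: NP.
Unshelve. all: by end_near.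
Qed.

Lemma unif_limit_continuous (T : topologicalType) (R : realType) (O : set T)
    (g : nat -> T -> R) (f : T -> R) (p : T) :
  open O -> O p -> (forall n, {for p, continuous (g n)}) ->
  (forall e, 0 < e -> exists N, forall n, (N <= n)%N -> forall q, O q -> `|g n q - f q| <= e) ->
  {for p, continuous f}.
Proof.
move=> oO Op cg u; apply/cvgrPdist_le => e e0.
have e3 : 0 < e / 3%:R by rewrite divr_gt0.
have [N NP] := u _ e3; have /cvgrPdist_le/(_ _ e3) H := cg N.
have nO : \forall q \near p, O q by exact: open_nbhs_nbhs.
apply: filterS2 nO H => q Oq.
have := NP N (leqnn _) q Oq; have := NP N (leqnn _) p Op; rewrite !ler_norml.
move=> /andP[? ?] /andP[? ?] /andP[? ?]; apply/andP; split; lra.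
Qed.

(** * Polar coordinates and the Cauchy estimate for the classical equations *)

Lemma is_derive_curve (R : realType) (W : normedModType R) (g : W -> R) (p e1 e2 : W)
    (x y : R -> R) (t x' y' : R) :
  differentiable g (p + x t *: e1 + y t *: e2) ->
  is_derive t 1 x x' -> is_derive t 1 y y' ->
  is_derive t 1 (fun s => g (p + x s *: e1 + y s *: e2))
    (x' * 'D_e1 g (p + x t *: e1 + y t *: e2) + y' * 'D_e2 g (p + x t *: e1 + y t *: e2)).
Proof.
move=> dg dx dy.
have Dx : differentiable x t by apply/derivable1_diffP; exact: ex_derive.
have Dy : differentiable y t by apply/derivable1_diffP; exact: ex_derive.
have Dxe : differentiable (fun s => x s *: e1) t by exact: differentiableZl.
have Dye : differentiable (fun s => y s *: e2) t by exact: differentiableZl.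
have Dp : differentiable ((cst p : R -> W) + (fun s => x s *: e1)) t.
  by apply: differentiableD.
have Dc : differentiable ((cst p : R -> W) + (fun s => x s *: e1) + (fun s => y s *: e2)) t.
  exact: differentiableD.
have dc : 'd ((cst p : R -> W) + (fun s => x s *: e1) + (fun s => y s *: e2)) t 1 =
    x' *: e1 + y' *: e2.
  rewrite diffD// diffD// diff_cst /= !add0r.
  rewrite diffZl// diffZl// -!deriveE//.
  by rewrite !derive_val.
set c := _ + _ + _ in Dc dc.
have cE : p + x t *: e1 + y t *: e2 = c t by [].
rewrite cE in dg *.
have dgc : differentiable (g \o c) t by exact: differentiable_comp.
split; first exact: diff_derivable.
rewrite deriveE// diff_comp//= dc linearD !linearZ /= -!deriveE//.
Qed.

Lemma is_derive_quotient_id (R : realType) (N : R -> R) (r n : R) :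
  r != 0 -> is_derive r 1 N n -> is_derive r 1 (fun s => N s / s) (n / r - N r / r ^+ 2).
Proof.
move=> r0 dN.
have dV : is_derive r 1 (fun s : R => s^-1) (- r ^- 2 *: 1).
  have H : is_derive r (1:R) (@id R) 1 by exact: is_derive_id.
  exact: is_deriveV r0 H.
have dM := is_deriveM dN dV.
apply: (is_derive_eq dM); rewrite /GRing.scale /=; field.
by [].
Qed.

(** The numerator is the imaginary part of [(A + i B) e^(-is)]. *)
Lemma is_derive_rotation (R : realType) (A B : R -> R) (t a b k : R) :
  is_derive t 1 A a -> is_derive t 1 B b ->
  is_derive t 1 (fun s => (B s * cos s - A s * sin s) / k)
    ((b * cos t - B t * sin t - a * sin t - A t * cos t) / k).
Proof.
move=> dA dB.
have dN := is_deriveB (is_deriveM dB (is_derive_cos t)) (is_deriveM dA (is_derive_sin t)).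
have dM := is_deriveM dN (is_derive_cst k^-1 t 1).
apply: (is_derive_eq dM); rewrite /GRing.scale /=; ring.
Qed.

Lemma normr_polar_le (R : realType) (W : normedModType R) (e1 e2 : W) (r t : R) :
  0 <= r -> `|(r * cos t) *: e1 + (r * sin t) *: e2| <= r * (`|e1| + `|e2|).
Proof.
move=> r0; have Hc : `|cos t| <= 1 by rewrite ler_norml cos_geN1 cos_le1.
have Hs : `|sin t| <= 1 by rewrite ler_norml sin_geN1 sin_le1.
rewrite (le_trans (ler_normD _ _))// !normrZ (ger0_norm r0) mulrDr -!mulrA.
by apply: lerD; rewrite ler_wpM2l// ler_piMl.
Qed.

(* In polar coordinates around [p], [P = Re ((f - f p) e^(-it)) / r] and
   [Q = Im ((f - f p) e^(-it)) / r^2] satisfy [dP/dr = dQ/dt = ('D_e1 U - P) / r] by the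
   Cauchy-Riemann equations, while [P] tends to ['D_e1 U p] as [r] tends to [0]. *)
Lemma cauchy_estimate (R : realType) (W : normedModType R) (U V : W -> R) (p e1 e2 : W)
    (rho M : R) (c := fun r t : R => p + (r * cos t) *: e1 + (r * sin t) *: e2) :
  0 < rho ->
  (forall r t, 0 <= r <= rho ->
    [/\ differentiable U (c r t), differentiable V (c r t),
        {for c r t, continuous ('D_e1 U)},
        'D_e1 U (c r t) = 'D_e2 V (c r t) & 'D_e2 U (c r t) = - 'D_e1 V (c r t)]) ->
  (forall r t, 0 <= r <= rho -> `|U (c r t)| <= M /\ `|V (c r t)| <= M) ->
  'D_e1 U p <= 4%:R * M / rho.
Proof.
move=> rho0 HUV HM.
have c0 t : c 0 t = p by rewrite /c !mul0r !scale0r !addr0.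
pose A r t := U (c r t) - U p; pose B r t := V (c r t) - V p.
pose N r t := A r t * cos t + B r t * sin t.
have dcos (r t : R) : is_derive t (1 : R) (fun s : R => r * cos s) (- r * sin t).
  apply: (is_derive_eq (is_deriveM (is_derive_cst r t 1) (is_derive_cos t))).
  by rewrite /GRing.scale /=; ring.
have dsin (r t : R) : is_derive t (1 : R) (fun s : R => r * sin s) (r * cos t).
  apply: (is_derive_eq (is_deriveM (is_derive_cst r t 1) (is_derive_sin t))).
  by rewrite /GRing.scale /=; ring.
have curve g (r t : R) : differentiable g (c r t) ->
    is_derive t (1 : R) (fun s => g (c r s))
      (- r * sin t * 'D_e1 g (c r t) + r * cos t * 'D_e2 g (c r t)).
  by move=> dg; apply: (is_derive_curve (x := fun s => r * cos s) (y := fun s => r * sin s)).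
have ray g (r t : R) : differentiable g (c r t) ->
    is_derive r (1 : R) (fun s => g (c s t)) (cos t * 'D_e1 g (c r t) + sin t * 'D_e2 g (c r t)).
  move=> dg; have dx (k : R) : is_derive r (1 : R) (fun s : R => s * k) k.
    apply: (is_derive_eq (is_deriveM (is_derive_id r 1) (is_derive_cst k r 1))).
    by rewrite /GRing.scale /=; ring.
  by apply: (is_derive_curve (x := fun s => s * cos t) (y := fun s => s * sin t)).
have dA (r t : R) : 0 <= r <= rho -> is_derive t (1 : R) (A r)
    (r * ('D_e2 U (c r t) * cos t - 'D_e1 U (c r t) * sin t)).
  move=> rI; have [dU _ _ _ _] := HUV r t rI.
  have H := is_deriveB (curve _ _ _ dU) (is_derive_cst (U p) t 1).
  by apply: (is_derive_eq H); ring.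
have dB (r t : R) : 0 <= r <= rho -> is_derive t (1 : R) (B r)
    (r * ('D_e1 U (c r t) * cos t + 'D_e2 U (c r t) * sin t)).
  move=> rI; have [_ dV _ E1 E2] := HUV r t rI.
  have H := is_deriveB (curve _ _ _ dV) (is_derive_cst (V p) t 1).
  by apply: (is_derive_eq H); rewrite E2 -E1; ring.
(* By the Cauchy-Riemann equations the terms in ['D_e2 U] cancel, and [cos^2 + sin^2 = 1] leaves a
   single partial derivative. *)
have dN (r t : R) : 0 <= r <= rho -> is_derive r (1 : R) (N^~ t) ('D_e1 U (c r t)).
  move=> rI; have [dU dV _ E1 E2] := HUV r t rI.
  have HA := is_deriveB (ray _ _ _ dU) (is_derive_cst (U p) r 1).
  have HB := is_deriveB (ray _ _ _ dV) (is_derive_cst (V p) r 1).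
  have H := is_deriveD (is_deriveM HA (is_derive_cst (cos t) r 1))
    (is_deriveM HB (is_derive_cst (sin t) r 1)).
  apply: (is_derive_eq H); rewrite /= E2 -E1 /GRing.scale /=.
  have := cos2Dsin2 t; set C := cos t; set S := sin t => CS.
  rewrite -[RHS]mulr1 -CS; ring.
apply/ler_addgt0Pr => e e0; rewrite -lerBlDr.
have [s1 /andP[s10 s1rho] Hs1] : exists2 s1, 0 < s1 < rho & forall r t, 0 <= r <= s1 ->
    'D_e1 U p - e <= 'D_e1 U (c r t).
  have I0 : 0 <= (0 : R) <= rho by rewrite lexx ltW.
  have [_ _ cU _ _] := HUV 0 0 I0; rewrite c0 in cU.
  have /cvgrPdist_le/(_ _ e0)/nbhs_ballP[d /= d0 dP] := cU.
  pose k := `|e1| + `|e2| + 1.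
  have k0 : 0 < k by rewrite ltr_pwDr// addr_ge0.
  have dk : 0 < d / k by rewrite divr_gt0.
  (* Half of [rho] gives [s1 < rho]; half of [d / k] puts the polar disc of radius [s1] inside
     [ball p d]. *)
  exists (Num.min (rho / 2) (d / k / 2)).
    by rewrite lt_min !divr_gt0//= gt_min; apply/orP; left; lra.
  move=> r t /andP[r0]; rewrite le_min => /andP[_ rd].
  have rk : r < d / k by lra.
  suff /dP : ball p d (c r t) by rewrite ler_norml => /andP[_]; lra.
  rewrite -ball_normE /= /c -addrA opprD addNKr normrN.
  rewrite (le_lt_trans (normr_polar_le _ _ _ r0))//.
  have : r * k < d by rewrite -ltr_pdivlMr.
  by rewrite /k mulrDr mulr1; lra.
(* The common derivative has [r] in its denominators, hence the comparison of the circles of radius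
   [s1] and [rho] rather than a start at [0]. *)
pose D (z : R * R) := ('D_e1 U (c z.1 z.2) - N z.1 z.2 / z.1) / z.1.
have pos r : s1 <= r <= rho -> (r != 0) /\ (0 <= r <= rho).
  by move=> /andP[sr ->]; rewrite gt_eqF ?(lt_le_trans s10)//= (le_trans (ltW s10)).
have s1I r : 0 <= r <= s1 -> 0 <= r <= rho.
  by move=> /andP[-> rs] /=; rewrite (le_trans rs) ?ltW.
apply: (@periodic_closed_form_le R (fun r t => N r t / r)
  (fun r t => (B r t * cos t - A r t * sin t) / r ^+ 2) D s1 rho (pi *+ 2)) => //.
- by rewrite mulrn_wgt0// pi_gt0.
- move=> r t /pos[r0 rI]; apply: (is_derive_eq (is_derive_quotient_id r0 (dN r t rI))).
  by rewrite /D /=; field.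
- move=> r t /pos[r0 rI].
  apply: (is_derive_eq (is_derive_rotation (r ^+ 2) (dA r t rI) (dB r t rI))).
  rewrite /D /N /=; have := cos2Dsin2 t; set C := cos t; set S := sin t => CS.
  have S2 : S ^+ 2 = 1 - C ^+ 2 by rewrite -CS; ring.
  by field: S2.
- move=> r t /pos[r0 rI]; have [dU dV cU _ _] := HUV r t rI.
  have c1 : {for (r, t), continuous (fun z : R * R => z.1)} by exact: cvg_fst.
  have cosc : {for (r, t), continuous (fun z : R * R => cos z.2)}.
    by apply: continuous_comp; [exact: cvg_snd|exact: continuous_cos].
  have sinc : {for (r, t), continuous (fun z : R * R => sin z.2)}.
    by apply: continuous_comp; [exact: cvg_snd|exact: continuous_sin].
  have cc : {for (r, t), continuous (fun z : R * R => c z.1 z.2)}.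
    by apply: continuousD; [apply: continuousD; [exact: cvg_cst|]|];
      apply: continuousZr_tmp; apply: continuousM.
  have comp g : {for c r t, continuous g} ->
      {for (r, t), continuous (fun z : R * R => g (c z.1 z.2) : R)}.
    by move=> cg; apply: (continuous_comp (f := fun z : R * R => c z.1 z.2)).
  have invc : {for (r, t), continuous (fun z : R * R => z.1^-1)} by exact: continuousV.
  have AB (g : W -> R) : differentiable g (c r t) ->
      {for (r, t), continuous (fun z : R * R => g (c z.1 z.2) - g p)}.
    move=> dg; have cg := comp g (differentiable_continuous dg).
    by apply: continuousB => //; exact: cvg_cst.
  apply: (continuousM (s := fun z : R * R => 'D_e1 U (c z.1 z.2) - N z.1 z.2 / z.1)) => //.
  apply: continuousB; first exact: comp _ cU.
  apply: (continuousM (s := fun z : R * R => N z.1 z.2)) => //.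
  by apply: continuousD; apply: continuousM => //; exact: AB.
- by move=> r _; rewrite /A /B /c cos2pi sin2pi cos0 sin0.
(* Inner circle: as [N 0 t = 0], the quotient [N s1 t / s1] is a value of ['D_e1 U] at a radius
   below [s1]. *)
- move=> t; rewrite ler_pdivlMr//.
  have [r||x xI] := @MVT_segment _ (N^~ t) (fun r => 'D_e1 U (c r t)) _ _ (ltW s10).
  + by rewrite in_itv /= => /andP[r0 rs]; apply/dN/s1I; rewrite !ltW.
  + apply: derivable_within_continuous => r; rewrite in_itv /= => /s1I rI.
    by have dd := dN r t rI; exact: ex_derive.
  rewrite in_itv /= in xI.
  have -> : N 0 t = 0 by rewrite /N /A /B c0 !subrr !mul0r addr0.
  by rewrite !subr0 => ->; rewrite ler_pM2r// Hs1.
(* Outer circle: [A] and [B] are differences of values bounded by [M], so [N rho t] is at most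
   [2M + 2M]. *)
- move=> t; rewrite ler_pM2r ?invr_gt0//.
  have I0 : 0 <= (0 : R) <= rho by rewrite lexx ltW.
  have I1 : 0 <= rho <= rho by rewrite lexx ltW.
  have := HM 0 t I0; have := HM rho t I1; rewrite c0 => -[Mu Mv] [Mu0 Mv0].
  have boundM a k : `|a| <= 2%:R * M -> `|k| <= 1 -> a * k <= 2%:R * M.
    move=> aM k1; rewrite (le_trans (ler_norm _))// normrM -[leRHS]mulr1.
    by apply: ler_pM.
  have H2 a a' : `|a| <= M -> `|a'| <= M -> `|a - a'| <= 2%:R * M.
    by move=> Ha Ha'; rewrite (le_trans (ler_normB _ _))// mulr_natl mulr2n lerD.
  have -> : 4%:R * M = 2%:R * M + 2%:R * M by ring.
  apply: lerD; apply: boundM.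
  + exact: H2.
  + by rewrite ler_norml cos_geN1 cos_le1.
  + exact: H2.
  + by rewrite ler_norml sin_geN1 sin_le1.
Qed.

(** * Bounds for the partial derivatives of holomorphic functions *)

Lemma is_derive_comb (R : realType) (W : normedModType R) (u v : W -> R) (k l : R) (q d : W) :
  derivable u q d -> derivable v q d ->
  is_derive q d (fun x => k * u x + l * v x) (k * 'D_d u q + l * 'D_d v q).
Proof.
move=> /derivableP du /derivableP dv.
exact: is_deriveD (is_deriveZ k du) (is_deriveZ l dv).
Qed.

Lemma C1_comb (R : realType) (Om : set (R * R)) (u v : R * R -> R) (k l : R) :
  open Om -> C1_on Om u -> C1_on Om v -> C1_on Om (fun x => k * u x + l * v x).
Proof.
move=> oOm [du [cux cuy]] [dv [cvx cvy]].
have cont (d p : R * R) : Om p ->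
    (forall q, Om q -> derivable u q d) -> (forall q, Om q -> derivable v q d) ->
    'D_d u q @[q --> p] --> 'D_d u p -> 'D_d v q @[q --> p] --> 'D_d v p ->
    'D_d (fun x => k * u x + l * v x) q @[q --> p] --> 'D_d (fun x => k * u x + l * v x) p.
  move=> Op Du Dv cu cv.
  have DE q : Om q -> 'D_d (fun x => k * u x + l * v x) q = k * 'D_d u q + l * 'D_d v q.
    by move=> Oq; have D := is_derive_comb k l (Du q Oq) (Dv q Oq); exact: derive_val.
  rewrite DE//.
  have C : (k * 'D_d u q + l * 'D_d v q) @[q --> p] --> k * 'D_d u p + l * 'D_d v p.
    by apply: cvgD; apply: cvgMr.
  apply: cvg_trans C; apply: near_eq_cvg.
  have nO : \forall q \near p, Om q by exact: open_nbhs_nbhs.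
  by apply: filterS nO => q /DE.
split=> [p Op|].
  have [ux uy] := du p Op; have [vx vy] := dv p Op.
  by have Dx := is_derive_comb k l ux vx; have Dy := is_derive_comb k l uy vy;
    split; exact: ex_derive.
split=> p Op.
  exact: (cont (ex R) p Op (fun q Oq => (du q Oq).1) (fun q Oq => (dv q Oq).1)
    (cux p Op) (cvx p Op)).
exact: (cont (ey R) p Op (fun q Oq => (du q Oq).2) (fun q Oq => (dv q Oq).2)
  (cuy p Op) (cvy p Op)).
Qed.

(** The difference is written with coefficients [1] and [-1] to be literally an instance of the
    linear combinations of [C1_comb]. *)
Lemma holomorphic_sub (R : realType) (a b : R) (Om : set (R * R)) (f g : R * R -> R * R) :
  open Om -> holomorphic a b Om f -> holomorphic a b Om g ->
  holomorphic a b Om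
    (fun q => (1 * (f q).1 + -1 * (g q).1, 1 * (f q).2 + -1 * (g q).2)).
Proof.
have lin1 (x y x' y' : R) : x - a * y = 0 -> x' - a * y' = 0 ->
    1 * x + -1 * x' - a * (1 * y + -1 * y') = 0 by lra.
have lin2 (x y z x' y' z' : R) : x + z - b * y = 0 -> x' + z' - b * y' = 0 ->
    1 * x + -1 * x' + (1 * z + -1 * z') - b * (1 * y + -1 * y') = 0 by lra.
move=> oOm [fu [fv CRf]] [gu [gv CRg]].
split; first exact: (C1_comb 1 (-1) oOm fu gu).
split; first exact: (C1_comb 1 (-1) oOm fv gv).
move=> p Op; have [E1 E2] := CRf p Op; have [E3 E4] := CRg p Op.
have [fux fuy] := fu.1 p Op; have [fvx fvy] := fv.1 p Op.
have [gux guy] := gu.1 p Op; have [gvx gvy] := gv.1 p Op.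
have Dux := is_derive_comb 1 (-1) fux gux; have Duy := is_derive_comb 1 (-1) fuy guy.
have Dvx := is_derive_comb 1 (-1) fvx gvx; have Dvy := is_derive_comb 1 (-1) fvy gvy.
rewrite /= (@derive_val _ _ _ _ _ _ _ Dux) (@derive_val _ _ _ _ _ _ _ Duy).
rewrite (@derive_val _ _ _ _ _ _ _ Dvx) (@derive_val _ _ _ _ _ _ _ Dvy).
by split; [exact: lin1|exact: lin2].
Qed.

(* With [w = sqrt (4a - b^2) / 2], [j = (i + b/2) / w] satisfies [j^2 = -1] and
   [u + i v = U + j V] for [U = u - b/2 v], [V = w v]; the pair [(U, V)] satisfies the
   classical Cauchy-Riemann equations in the directions [e1 = (0, 1)] and
   [e2 = (-1/w, b/(2w))]. *)
Lemma holomorphic_partials_bound (R : realType) (a b : R) : 0 < 4 * a - b ^+ 2 ->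
  exists2 K, 0 < K & forall (Om : set (R * R)) (f : R * R -> R * R) (p : R * R) (e M : R),
    open Om -> holomorphic a b Om f -> 0 < e ->
    (forall q, `|q - p| <= e -> Om q) ->
    (forall q, `|q - p| <= e -> `|(f q).1| <= M /\ `|(f q).2| <= M) ->
    [/\ `|'D_(ex R) (fun q => (f q).1) p| <= K * M / e,
        `|'D_(ey R) (fun q => (f q).1) p| <= K * M / e,
        `|'D_(ex R) (fun q => (f q).2) p| <= K * M / e &
        `|'D_(ey R) (fun q => (f q).2) p| <= K * M / e].
Proof.
move=> ab0; pose w := Num.sqrt (4 * a - b ^+ 2) / 2.
have w0 : 0 < w by rewrite divr_gt0 ?sqrtr_gt0.
have ww : w * w = a - b * b / 4.
  by rewrite /w mulrACA -expr2 sqr_sqrtr ?ltW//; field.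
have wn0 : w != 0 by rewrite gt_eqF.
pose e1 := ey R; pose e2 : R * R := (- w^-1, b / (2 * w)).
pose E := `|e1| + `|e2| + 1.
have E0 : 0 < E by rewrite ltr_pwDr// addr_ge0.
(* Dominates the sum of the absolute coefficients of [U], [V] and their opposites, all of which are
   thus bounded by [C * M]. *)
pose C := 1 + `|b| + w.
have C0 : 0 < C by rewrite /C; have := normr_ge0 b; lra.
(* Chosen so that [K * M / e] equals [X + (1 + |a| + 2 |b|) Y], with [X] the bound for [U] and
   [Y = X / w] the bound for [v] below. *)
pose K := 4 * C * E * (1 + (1 + `|a| + 2 * `|b|) / w).
have K0 : 0 < K.
  by rewrite !mulr_gt0// ltr_pwDl// divr_ge0 ?ltW//.
exists K => // Om f p e M oOm [fu [fv CR]] e0 eOm fM.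
pose u q := (f q).1; pose v q := (f q).2.
pose L k l q := k * u q + l * v q.
have LC1 k l : C1_on Om (L k l) := C1_comb k l oOm fu fv.
have DLx k l q : Om q -> 'D_(ex R) (L k l) q = k * 'D_(ex R) u q + l * 'D_(ex R) v q.
  move=> Oq; have D := is_derive_comb k l (fu.1 q Oq).1 (fv.1 q Oq).1; exact: derive_val.
have DLy k l q : Om q -> 'D_(ey R) (L k l) q = k * 'D_(ey R) u q + l * 'D_(ey R) v q.
  move=> Oq; have D := is_derive_comb k l (fu.1 q Oq).2 (fv.1 q Oq).2; exact: derive_val.
(* The direction [e2] is oblique: linearity of the derivative in the direction comes from
   differentiability. *)
have DL2 k l q : Om q -> 'D_e2 (L k l) q =
    - w^-1 * 'D_(ex R) (L k l) q + b / (2 * w) * 'D_(ey R) (L k l) q.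
  move=> Oq; have dL := C1_differentiable oOm (LC1 k l) Oq.
  have -> : e2 = - w^-1 *: ex R + b / (2 * w) *: ey R.
    congr pair => /=.
      by rewrite [X in X + _]mulr1 [X in _ + X]mulr0 addr0.
    by rewrite [X in X + _]mulr0 [X in _ + X]mulr1 add0r.
  by rewrite !deriveE// linearD !linearZ.
pose rho := e / E.
have rho0 : 0 < rho by rewrite divr_gt0.
pose X := 4 * (C * M) / rho.
have M0 : 0 <= M.
  have pe : `|p - p| <= e by rewrite subrr normr0 ltW.
  exact: le_trans (normr_ge0 _) (fM p pe).1.
(* The Cauchy estimate bounds from above only; with free coefficients it also applies to the
   opposite functions, which gives the lower bounds. *)
have est k l k' l' : `|k| + `|l| <= C -> `|k'| + `|l'| <= C ->
   (forall q, Om q -> 'D_(ey R) (L k l) q = 'D_e2 (L k' l') q) ->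
   (forall q, Om q -> 'D_e2 (L k l) q = - 'D_(ey R) (L k' l') q) ->
   'D_(ey R) (L k l) p <= X.
  move=> klC klC' cr1 cr2.
  have near_p r t : 0 <= r <= rho ->
      `|p + (r * cos t) *: e1 + (r * sin t) *: e2 - p| <= e.
    move=> /andP[r0 rr]; rewrite -(addrA p) addrAC subrr add0r.
    rewrite (le_trans (normr_polar_le _ _ _ r0))//.
    have : r * E <= e by rewrite -ler_pdivlMr.
    by rewrite /E mulrDr mulr1; lra.
  have LM k0 l0 q : `|k0| + `|l0| <= C -> `|q - p| <= e -> `|L k0 l0 q| <= C * M.
    move=> kl /fM[uM vM]; rewrite (le_trans (ler_normD _ _))// !normrM.
    apply: (@le_trans _ _ ((`|k0| + `|l0|) * M)); last by rewrite ler_wpM2r.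
    by rewrite mulrDl; apply: lerD; rewrite ler_wpM2l.
  apply: (cauchy_estimate (V := L k' l') (e1 := e1) (e2 := e2)) => //.
    move=> r t /(near_p r t) /eOm Oq; split.
    - exact: C1_differentiable oOm (LC1 k l) Oq.
    - exact: C1_differentiable oOm (LC1 k' l') Oq.
    - exact: (LC1 k l).2.2.
    - exact: cr1.
    - exact: cr2.
  by move=> r t /(near_p r t) qe; split; apply: LM.
have Pp : Om p by apply: eOm; rewrite subrr normr0 ltW.
have b2 : `|b / 2| <= `|b| by rewrite normrM ler_piMr// ger0_norm; lra.
have C1 : `|1| + `|- (b / 2)| <= C.
  by rewrite normr1 normrN /C -addrA lerD2l (le_trans b2)// lerDl ltW.
have C1' : `|-1| + `|b / 2| <= C by move: C1; rewrite !normrN.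
have Cw : `|0 : R| + `|w| <= C.
  by rewrite normr0 add0r gtr0_norm// /C lerDr addr_ge0.
have Cw' : `|0 : R| + `|- w| <= C by rewrite normrN.
(* The equations solved for the [x]-partials: it is enough to bound the two [y]-partials. *)
have D1 q : Om q -> [/\ 'D_(ex R) u q = a * 'D_(ey R) v q &
    'D_(ex R) v q = b * 'D_(ey R) v q - 'D_(ey R) u q].
  move=> Oq; have [] := CR q Oq; rewrite -/u -/v => H1 H2; split; first exact: subr0_eq.
  by apply/eqP; rewrite -subr_eq0 -H2; apply/eqP; ring.
have [U1 U2 V1 V2] : [/\ 'D_(ey R) (L 1 (- (b / 2))) p <= X,
    'D_(ey R) (L (-1) (b / 2)) p <= X, 'D_(ey R) (L 0 w) p <= X &
    'D_(ey R) (L 0 (- w)) p <= X].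
  (* The pairs [(U, V)], [(-U, -V)], [(V, -U)], [(-V, U)] all satisfy Cauchy-Riemann. *)
  have a_ww : a = w * w + b * b / 4 by rewrite ww; ring.
  split; [apply: (est _ _ 0 w)|apply: (est _ _ 0 (- w))|
    apply: (est _ _ (-1) (b / 2))|apply: (est _ _ 1 (- (b / 2)))] => // q Oq;
    have [xu xv] := D1 q Oq; rewrite DL2// !DLx// !DLy// xu xv ?a_ww; field; exact: wn0.
have [] := D1 p Pp; rewrite -/u -/v => -> ->; move: U1 U2 V1 V2; rewrite !DLy//.
set s := 'D_(ey R) u p; set y := 'D_(ey R) v p => U1 U2 V1 V2.
have X0 : 0 <= X by rewrite /X divr_ge0 ?(ltW rho0)// !mulr_ge0// ltW.
pose Y := X / w.
have Y0 : 0 <= Y by rewrite divr_ge0 ?(ltW w0).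
have -> : K * M / e = X + Y + `|a| * Y + 2 * (`|b| * Y).
  by rewrite /K /Y /X /rho; field; rewrite wn0 !gt_eqF.
(* The bounds on [V = w v] and its opposite control [y]; those on [U] then keep [s] within [X] of
   [b y / 2]. *)
have yY : `|y| <= Y.
  rewrite /Y ler_pdivlMr// -(gtr0_norm w0) -normrM mulrC ler_norml lerNl.
  by move: V1 V2; rewrite !mul0r !add0r mulNr => -> ->.
have ay : `|a * y| <= `|a| * Y by rewrite normrM ler_wpM2l.
have bY' : `|b * y| <= `|b| * Y by rewrite normrM ler_wpM2l.
have aY : 0 <= `|a| * Y by rewrite mulr_ge0.
have bY : 0 <= `|b| * Y by rewrite mulr_ge0.
have bs : b / 2 * y = (b * y) / 2 by ring.
move: yY ay bY'; rewrite mulNr !mul1r bs in U1 U2; rewrite !ler_norml.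
clear - X0 Y0 aY bY U1 U2.
move=> /andP[? ?] /andP[? ?] /andP[? ?]; split; apply/andP; split; lra.
Qed.

(** * Passage to the limit *)

(** The bound is applied to [fn n - fn m] on squares of one fixed size around every [q] near [p],
    all inside one compact square; its constant depends only on [a] and [b], hence the uniformity in
    [q]. *)
Lemma partials_locally_cauchy (R : realType) (a b : R) (Om : set (R * R))
    (fn : nat -> R * R -> R * R) (f : R * R -> R * R) (p : R * R) :
  0 < 4 * a - b ^+ 2 -> open Om -> (forall n, holomorphic a b Om (fn n)) ->
  unif_cvg_compact Om fn f -> Om p ->
  exists O : set (R * R), [/\ open O, O p, O `<=` Om &
    forall e, 0 < e -> exists N, forall n m, (N <= n)%N -> (N <= m)%N -> forall q, O q ->
    [/\ `|'D_(ex R) (fun x => (fn n x).1) q - 'D_(ex R) (fun x => (fn m x).1) q| <= e,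
        `|'D_(ey R) (fun x => (fn n x).1) q - 'D_(ey R) (fun x => (fn m x).1) q| <= e,
        `|'D_(ex R) (fun x => (fn n x).2) q - 'D_(ex R) (fun x => (fn m x).2) q| <= e &
        `|'D_(ey R) (fun x => (fn n x).2) q - 'D_(ey R) (fun x => (fn m x).2) q| <= e]].
Proof.
move=> ab0 oOm fhol fcvg Omp.
have [K K0 HK] := holomorphic_partials_bound ab0.
have /nbhs_ballP[d /= d0 dOm] : \forall q \near p, Om q by exact: open_nbhs_nbhs.
(* Points within [r] of some [q] in [ball p r] lie in the square of half-side [2r = d / 2], which is
   inside [Om]. *)
pose r := d / 4.
have r0 : 0 < r by rewrite divr_gt0.
pose S := `[p.1 - 2 * r, p.1 + 2 * r] `*` `[p.2 - 2 * r, p.2 + 2 * r].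
have cS : compact S by apply: compact_setX; exact: segment_compact.
have inS q : `|q - p| <= 2 * r -> S q.
  rewrite prod_normE /= ge_max => /andP[]; rewrite !ler_norml => /andP[? ?] /andP[? ?].
  by split; rewrite /= in_itv /=; apply/andP; split; lra.
have SOm : S `<=` Om.
  have r2 : 2 * r < d by rewrite /r; lra.
  move=> q [/=]; rewrite !in_itv /= => /andP[? ?] /andP[? ?]; apply: dOm.
  by split; rewrite /ball /= /ball_ ltr_norml; apply/andP; split; lra.
have near_q q x : ball p r q -> `|x - q| <= r -> S x.
  rewrite -ball_normE /= distrC => pq xq; apply: inS.
  by rewrite (le_trans (ler_distD q _ _))//; lra.
exists (ball p r); split; first exact: ball_open.
- exact: ballxx.
- by move=> q pq; apply/SOm/(near_q q q pq); rewrite subrr normr0 ltW.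
(* This [M] turns the bound [K * M / r] into [e]; each of [fn n] and [fn m] is taken within [M / 2]
   of [f]. *)
move=> e e0; pose M := e * r / K.
have M0 : 0 < M by rewrite divr_gt0// mulr_gt0.
have KM : K * M / r = e by rewrite /M; field; rewrite !gt_eqF.
have [|N NP] := fcvg S SOm cS (M / 2); first by rewrite divr_gt0.
exists N => n m Nn Nm q pq.
have Omq : Om q by apply/SOm/(near_q q q pq); rewrite subrr normr0 ltW.
have qOm x : `|x - q| <= r -> Om x by move=> /(near_q q x pq) /SOm.
have qM x : `|x - q| <= r ->
    `|1 * (fn n x).1 + -1 * (fn m x).1| <= M /\ `|1 * (fn n x).2 + -1 * (fn m x).2| <= M.
  move=> /(near_q q x pq) Sx; have [] := NP n Nn x Sx; have [] := NP m Nm x Sx.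
  rewrite !ltr_norml !ler_norml.
  move=> /andP[? ?] /andP[? ?] /andP[? ?] /andP[? ?].
  by split; apply/andP; split; lra.
have [] := HK _ _ _ _ _ oOm (holomorphic_sub oOm (fhol n) (fhol m)) r0 qOm qM.
have [fu [fv _]] := fhol n; have [gu [gv _]] := fhol m.
have [fux fuy] := fu.1 q Omq; have [fvx fvy] := fv.1 q Omq.
have [gux guy] := gu.1 q Omq; have [gvx gvy] := gv.1 q Omq.
have Dux := is_derive_comb 1 (-1) fux gux; have Duy := is_derive_comb 1 (-1) fuy guy.
have Dvx := is_derive_comb 1 (-1) fvx gvx; have Dvy := is_derive_comb 1 (-1) fvy gvy.
rewrite /= (@derive_val _ _ _ _ _ _ _ Dux) (@derive_val _ _ _ _ _ _ _ Duy).
rewrite (@derive_val _ _ _ _ _ _ _ Dvx) (@derive_val _ _ _ _ _ _ _ Dvy).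
have E x y : 1 * x + -1 * y = x - y :> R by rewrite mul1r mulN1r.
by rewrite KM !E => -[H1 H2 H3 H4]; split; [exact: H1|exact: H2|exact: H3|exact: H4].
Qed.

(** Gathers what is needed of one real component in one direction; the last clause carries the
    linear equations to the limit. *)
Definition C1_limit_at (R : realType) (V : normedModType R) (g : nat -> V -> R) (f : V -> R)
    (d p : V) : Prop :=
  [/\ derivable f p d, {for p, continuous ('D_d f)} &
      'D_d (g n) p @[n --> \oo] --> 'D_d f p].

Lemma C1_limit (R : realType) (V : normedModType R) (O : set V) (d p : V)
    (g : nat -> V -> R) (f : V -> R) :
  open O -> O p ->
  (forall n q, O q -> derivable (g n) q d /\ {for q, continuous ('D_d (g n))}) ->
  (forall e, 0 < e -> exists N, forall n m, (N <= n)%N -> (N <= m)%N ->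
     forall q, O q -> `|'D_d (g n) q - 'D_d (g m) q| <= e) ->
  (forall q, O q -> g n q @[n --> \oo] --> f q) ->
  C1_limit_at g f d p.
Proof.
move=> oO Op dg cau gf.
have [df u] := derivable_limit oO (fun n q Oq => (dg n q Oq).1) cau gf.
split; first exact: df.
  exact: (unif_limit_continuous oO Op (fun n => (dg n p Op).2) u).
apply/cvgrPdist_le => e /u[N NP]; exists N => // n /= Nn.
by rewrite distrC; exact: NP.
Qed.

Theorem theorem1 (R : realType) (a b : R) (Om : set (R * R))
  (fn : nat -> R * R -> R * R) (f : R * R -> R * R) :
  0 < 4 * a - b ^+ 2 ->
  open Om -> connected Om ->
  (forall n, holomorphic a b Om (fn n)) ->
  unif_cvg_compact Om fn f ->
  holomorphic a b Om f.
Proof.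
move=> ab0 oOm _ fhol fcvg.
have pw q : Om q -> (fn n q).1 @[n --> \oo] --> (f q).1 /\ (fn n q).2 @[n --> \oo] --> (f q).2.
  (* A singleton is compact, so compact convergence includes pointwise convergence. *)
  move=> Oq; have sub1 : [set q] `<=` Om by move=> _ ->.
  split; apply/cvgrPdist_lt => e e0;
    have [N NP] := fcvg _ sub1 (@compact_set1 _ q) e e0;
    exists N => // n /= Nn; have [H1 H2] := NP n Nn q erefl; by rewrite distrC.
have loc p : Om p ->
    [/\ C1_limit_at (fun n x => (fn n x).1) (fun x => (f x).1) (ex R) p,
        C1_limit_at (fun n x => (fn n x).1) (fun x => (f x).1) (ey R) p,
        C1_limit_at (fun n x => (fn n x).2) (fun x => (f x).2) (ex R) p &
        C1_limit_at (fun n x => (fn n x).2) (fun x => (f x).2) (ey R) p].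
  move=> Omp; have [B [oB Bp BOm cau]] := partials_locally_cauchy ab0 oOm fhol fcvg Omp.
  have lim1 q : B q -> (fn n q).1 @[n --> \oo] --> (f q).1 by move=> /BOm /pw[].
  have lim2 q : B q -> (fn n q).2 @[n --> \oo] --> (f q).2 by move=> /BOm /pw[].
  split; apply: (C1_limit oB Bp) => //.
  - by move=> n q /BOm Oq; have [[du [cx cy]] _] := fhol n; split; [exact: (du q Oq).1|exact: cx].
  - move=> e /cau[N NP]; exists N => n m Nn Nm q Oq.
    by have [H _ _ _] := NP n m Nn Nm q Oq; exact: H.
  - by move=> n q /BOm Oq; have [[du [cx cy]] _] := fhol n; split; [exact: (du q Oq).2|exact: cy].
  - move=> e /cau[N NP]; exists N => n m Nn Nm q Oq.
    by have [_ H _ _] := NP n m Nn Nm q Oq; exact: H.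
  - by move=> n q /BOm Oq; have [_ [] [dv [cx cy]] _] := fhol n;
      split; [exact: (dv q Oq).1|exact: cx].
  - move=> e /cau[N NP]; exists N => n m Nn Nm q Oq.
    by have [_ _ H _] := NP n m Nn Nm q Oq; exact: H.
  - by move=> n q /BOm Oq; have [_ [] [dv [cx cy]] _] := fhol n;
      split; [exact: (dv q Oq).2|exact: cy].
  - move=> e /cau[N NP]; exists N => n m Nn Nm q Oq.
    by have [_ _ _ H] := NP n m Nn Nm q Oq; exact: H.
split.
  split=> [p /loc[[d1 _ _] [d2 _ _] _ _]|]; first by split; [exact: d1|exact: d2].
  by split=> p /loc[[_ c1 _] [_ c2 _] _ _]; [exact: c1|exact: c2].
split.
  split=> [p /loc[_ _ [d1 _ _] [d2 _ _]]|]; first by split; [exact: d1|exact: d2].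
  by split=> p /loc[_ _ [_ c1 _] [_ c2 _]]; [exact: c1|exact: c2].
move=> p Op; have [[_ _ ux] [_ _ uy] [_ _ vx] [_ _ vy]] := loc p Op; split.
  (* The left-hand side of each equation is constantly [0] along the sequence, and so is its
     limit. *)
  have := cvgB ux (cvgM (cvg_cst a) vy).
  have -> : (fun n => 'D_(ex R) (fun x => (fn n x).1) p) -
      (fun n => a * 'D_(ey R) (fun x => (fn n x).2) p) = cst 0.
    by apply/funext => n; have [_ [_ CR]] := fhol n; have [] := CR p Op.
  by move=> /(_ _ _ _) /(cvg_lim (@Rhausdorff R)) <-; exact: lim_cst.
have := cvgB (cvgD uy vx) (cvgM (cvg_cst b) vy).
have -> : (fun n => 'D_(ey R) (fun x => (fn n x).1) p) + 
    (fun n => 'D_(ex R) (fun x => (fn n x).2) p) -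
    (fun n => b * 'D_(ey R) (fun x => (fn n x).2) p) = cst 0.
  by apply/funext => n; have [_ [_ CR]] := fhol n; have [] := CR p Op.
by move=> /(_ _ _ _ _) /(cvg_lim (@Rhausdorff R)) <-; exact: lim_cst.
Qed.
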